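(* Let $R$ be a commutative unital ring. For every integer $n\geq 2$, the standard identity of degree $4n-2$ is a polynomial identity of both $M_nE^2$ and $M_nE^3$.
   Context: $E^m=R\langle v_1,\dots,v_m\rangle/(v_i^2,\ v_iv_j+v_jv_i \mid 1\le i,j\le m)$ is the $m$-generated Grassmann algebra over $R$, and $M_nE^m$ is the ring of $n\times n$ matrices over $E^m$. The standard polynomial of degree $k$ is $s_k(x_1,\dots,x_k)=\sum_{\pi\in\mathfrak{S}_k}\mathrm{sgn}(\pi)x_{\pi(1)}\cdots x_{\pi(k)}$; it is a polynomial identity if it vanishes for all substitutions of elements of the algebra. *)

(* Defs.v *)
From mathcomp Require Import all_boot all_order all_fingroup all_algebra.
Set Implicit Arguments. Unset Strict Implicit. Unset Printing Implicit Defensive.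
Import GRing.Theory.
Local Open Scope ring_scope.

(* The m-generated Grassmann algebra E^m over R, in its standard basis model:
   an element is the family of its coordinates on the basis monomials
   e_S = v_{i1} ... v_{ik} (i1 < ... < ik, S = {i1,...,ik} a subset of 'I_m). *)
Definition grass (R : comPzRingType) (m : nat) := {ffun {set 'I_m} -> R}.

(* number of inversions when concatenating the sorted monomials e_S and e_T *)
Definition grinv (m : nat) (S T : {set 'I_m}) : nat :=
  #|[set p : 'I_m * 'I_m | (p.1 \in S) && (p.2 \in T) && (p.2 < p.1)%N]|.

(* multiplication: e_S e_T = 0 if S, T meet, else (-1)^inv(S,T) e_(S u T) *)
Definition grmul (R : comPzRingType) (m : nat) (a b : grass R m) : grass R m :=
  [ffun U : {set 'I_m} => \sum_(S : {set 'I_m}) \sum_(T : {set 'I_m})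
     (if (S :&: T == set0) && (S :|: T == U)
      then (-1) ^+ grinv S T * a S * b T else 0)].

Definition grone (R : comPzRingType) (m : nat) : grass R m :=
  [ffun S : {set 'I_m} => if S == set0 then 1 else 0].

Definition grmxmul (R : comPzRingType) (m n : nat) (A B : 'M[grass R m]_n)
  : 'M[grass R m]_n :=
  \matrix_(i, j) \sum_(k < n) grmul (A i k) (B k j).

Definition grmx1 (R : comPzRingType) (m n : nat) : 'M[grass R m]_n :=
  \matrix_(i, j) (if i == j then grone R m else 0).

Definition grmxprod (R : comPzRingType) (m n : nat) (l : seq 'M[grass R m]_n)
  : 'M[grass R m]_n := foldr (@grmxmul R m n) (grmx1 R m n) l.

Definition std_poly (R : comPzRingType) (m n k : nat) (x : 'I_k -> 'M[grass R m]_n)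
  : 'M[grass R m]_n :=
  \sum_(s : 'S_k)
    (if odd_perm s then - grmxprod [seq x (s i) | i <- enum 'I_k]
     else grmxprod [seq x (s i) | i <- enum 'I_k]).

Definition std_identity (R : comPzRingType) (m n k : nat) : Prop :=
  forall x : 'I_k -> 'M[grass R m]_n, std_poly x = 0.

(* Main.v *)
(** The identity is multilinear, so it may be checked on matrix units times basis
    monomials, hence over [int]. Let [Lam] be a Grassmann algebra over [int] with one
    generator [theta_i] for each variable [x_i] and two spare generators [eta], [zeta], and
    let [Y := \sum_i theta_i x_i], where the [theta_i] commute with the [v_j]; then [Y ^+ N]
    is [theta_1 ... theta_N] times the standard polynomial of the [x_i].

    Write [d] for the matrix size, and [h_s(A; B_1, ..., B_k)] for the sum of the words
    [A^i_0 B_1 A^i_1 ... B_k A^i_k] with [i_0 + ... + i_k = s]. An odd matrix [A] over [Lam]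
    satisfies [A ^+ (2 * d) = 0] (Rosset's proof of the Amitsur-Levitzki theorem). Replacing
    [A] by [A + t B] for all integers [t] and comparing the terms linear in [t] gives
    [h_s(A; B) = 0] for [s >= 2 * d - 1] and [B] odd, and, with [B] replaced by [eta B], the
    same with signs [(-1)^i_0] for [B] even. For [i + j + k = 4 * d - 4] the traces
    [tr (D A^i B A^j C A^k)] are cyclically invariant, and both families of relations make
    their sums along the lines of the triangle of exponents vanish, except close to the
    boundary; weighting the lines by their distance to the boundary shows that the total
    sum vanishes. This is where [d >= 2] is needed. So [h_(4d-4)(A; B, C) = 0] up to the
    factor [eta * zeta], and its linear term in the direction of [D] is a shuffle relation:
    the sum of [h_(4d-5)] over the insertions of [D] into the word [B, C] vanishes.

    Expanding [Y ^+ (4 * d - 2)] in the degree with respect to the [v_j], degrees 0, 1 and 2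
    vanish by these identities, and the shuffle relation kills the alternating sum in
    degree 3. There is no higher degree for at most three [v_j]. *)
Require Import Defs.
From HB Require Import structures.
From mathcomp Require Import all_boot all_order all_fingroup all_algebra.
From mathcomp Require Import zify.
Set Implicit Arguments. Unset Strict Implicit. Unset Printing Implicit Defensive.
Import GRing.Theory.
Local Open Scope ring_scope.

(** * Exterior algebras *)

Lemma big_setU_disjoint (Z : Type) (idx : Z) (op : Monoid.com_law idx) (T : finType)
    (A B : {set T}) (F : T -> Z) : [disjoint A & B] ->
  \big[op/idx]_(i in A :|: B) F i = op (\big[op/idx]_(i in A) F i) (\big[op/idx]_(i in B) F i).
Proof. by move=> dAB; rewrite -bigU //; apply: eq_bigl => i; rewrite !inE. Qed.

Lemma disjoint_setUl (T : finType) (A B C : {set T}) :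
  [disjoint A :|: B & C] = [disjoint A & C] && [disjoint B & C].
Proof. by rewrite -!setI_eq0 setIUl setU_eq0. Qed.

Lemma disjoint_setUr (T : finType) (A B C : {set T}) :
  [disjoint A & B :|: C] = [disjoint A & B] && [disjoint A & C].
Proof. by rewrite -!setI_eq0 setIUr setU_eq0. Qed.

Section Inversions.
Variable m : nat.
Implicit Types S T U : {set 'I_m}.

Lemma grinvE S T : grinv S T = (\sum_(i in S) \sum_(j in T) (j < i))%N.
Proof.
rewrite /grinv -sum1_card pair_big_dep big_mkcond [RHS]big_mkcond.
by apply: eq_bigr => p _; rewrite !inE; do 2 case: (_ \in _); case: (_ < _)%N.
Qed.

Lemma grinv0l T : grinv set0 T = 0%N.
Proof. by rewrite grinvE big_set0. Qed.

Lemma grinv0r S : grinv S set0 = 0%N.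
Proof. by rewrite grinvE big1 // => i _; rewrite big_set0. Qed.

Lemma grinvUl S T U : [disjoint S & T] ->
  grinv (S :|: T) U = (grinv S U + grinv T U)%N.
Proof. by move=> dST; rewrite !grinvE big_setU_disjoint. Qed.

Lemma grinvUr S T U : [disjoint T & U] ->
  grinv S (T :|: U) = (grinv S T + grinv S U)%N.
Proof.
move=> dTU; rewrite !grinvE -big_split.
by apply: eq_bigr => i _; rewrite big_setU_disjoint.
Qed.

Lemma grinvC S T : [disjoint S & T] -> (grinv S T + grinv T S = #|S| * #|T|)%N.
Proof.
move=> dST; rewrite !grinvE [X in (_ + X)%N]exchange_big -big_split -sum_nat_const.
apply: eq_bigr => i iS; rewrite -big_split -sum1_card; apply: eq_bigr => j jT.
rewrite /=; case: ltngtP => // /val_inj ji.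
by have := disjointFr dST iS; rewrite -ji jT.
Qed.

End Inversions.

(* The generators commute with the coefficient ring M, which need not be
   commutative; for a commutative R, [ext R m] is [grass R m]. *)
Definition ext (M : pzRingType) (m : nat) := {ffun {set 'I_m} -> M}.

Section ExtRing.
Variables (M : pzRingType) (m : nat).
Implicit Types (S T U : {set 'I_m}) (a b c : ext M m) (x y z : M).

HB.instance Definition _ := GRing.Zmodule.on (ext M m).

Definition emono S x : ext M m := [ffun U => if U == S then x else 0].

Definition extmul a b : ext M m :=
  [ffun U : {set 'I_m} => \sum_(S : {set 'I_m}) \sum_(T : {set 'I_m})
     (if (S :&: T == set0) && (S :|: T == U)
      then (-1) ^+ grinv S T * a S * b T else 0)].

Definition extone : ext M m := [ffun S : {set 'I_m} => if S == set0 then 1 else 0].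

Fact emono_zmod_morphism S : zmod_morphism (emono S).
Proof. by move=> x y; apply/ffunP => U; rewrite !ffunE; case: eqP; rewrite ?subr0. Qed.

HB.instance Definition _ S :=
  GRing.isZmodMorphism.Build M (ext M m) (emono S) (emono_zmod_morphism S).

Lemma ext_sumE I (r : seq I) (P : pred I) (F : I -> ext M m) S :
  (\sum_(i <- r | P i) F i) S = \sum_(i <- r | P i) F i S.
Proof. by elim/big_rec2: _ => [|i y1 y2 _ <-]; rewrite ffunE. Qed.

Lemma ext_sum_emono a : a = \sum_S emono S (a S).
Proof.
apply/ffunP => U; rewrite ext_sumE (bigD1 U) //= ffunE eqxx big1 ?addr0 // => S.
by rewrite ffunE eq_sym => /negPf ->.
Qed.

Lemma extmul_sum a b : extmul a b = \sum_(S : {set 'I_m}) \sum_(T : {set 'I_m})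
  (if [disjoint S & T] then emono (S :|: T) ((-1) ^+ grinv S T * a S * b T) else 0).
Proof.
apply/ffunP => U; rewrite ffunE ext_sumE; apply: eq_bigr => S _.
rewrite ext_sumE; apply: eq_bigr => T _; rewrite setI_eq0 eq_sym.
by case: [disjoint S & T]; rewrite /= ffunE.
Qed.

Lemma extmulDl : left_distributive extmul +%R.
Proof.
move=> a b c; rewrite !extmul_sum -big_split; apply: eq_bigr => S _ /=.
rewrite -big_split; apply: eq_bigr => T _ /=.
by case: ifP; rewrite ?addr0 // ffunE mulrDr mulrDl raddfD.
Qed.

Lemma extmulDr : right_distributive extmul +%R.
Proof.
move=> a b c; rewrite !extmul_sum -big_split; apply: eq_bigr => S _ /=.
rewrite -big_split; apply: eq_bigr => T _ /=.
by case: ifP; rewrite ?addr0 // ffunE mulrDr raddfD.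
Qed.

Lemma extmul0l a : extmul 0 a = 0.
Proof. by apply: (addrI (extmul 0 a)); rewrite -extmulDl !addr0. Qed.

Lemma extmul0r a : extmul a 0 = 0.
Proof. by apply: (addrI (extmul a 0)); rewrite -extmulDr !addr0. Qed.

Lemma extmul_suml I (r : seq I) (P : pred I) (F : I -> ext M m) a :
  extmul (\sum_(i <- r | P i) F i) a = \sum_(i <- r | P i) extmul (F i) a.
Proof. exact: (big_morph (extmul^~ a) (fun b c => extmulDl b c a) (extmul0l a)). Qed.

Lemma extmul_sumr I (r : seq I) (P : pred I) (F : I -> ext M m) a :
  extmul a (\sum_(i <- r | P i) F i) = \sum_(i <- r | P i) extmul a (F i).
Proof. exact: (big_morph (extmul a) (extmulDr a) (extmul0r a)). Qed.

Lemma extmul_emono S T x y : extmul (emono S x) (emono T y) =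
  if [disjoint S & T] then emono (S :|: T) ((-1) ^+ grinv S T * x * y) else 0.
Proof.
have emonoN S' z : S' != S -> emono S z S' = 0 by rewrite ffunE => /negPf->.
rewrite extmul_sum (bigD1 S) //= [X in _ + X]big1 ?addr0 => [|S' neqS]; last first.
  by rewrite big1 // => T' _; rewrite emonoN // mulr0 mul0r raddf0; case: ifP.
rewrite (bigD1 T) //= [X in _ + X]big1 ?addr0 => [|T' /negPf neqT]; last first.
  by rewrite [X in _ * X]ffunE neqT mulr0 raddf0; case: ifP.
by rewrite !ffunE !eqxx.
Qed.

Lemma extmulA : associative extmul.
Proof.
move=> a b c; rewrite (ext_sum_emono a) !extmul_suml; apply: eq_bigr => S _.
rewrite (ext_sum_emono b) extmul_suml !extmul_sumr extmul_suml; apply: eq_bigr => T _.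
rewrite (ext_sum_emono c) !extmul_sumr; apply: eq_bigr => U _; rewrite !extmul_emono.
case dTU : [disjoint T & U]; case dST : [disjoint S & T];
  rewrite ?extmul_emono ?extmul0l ?extmul0r ?disjoint_setUl ?disjoint_setUr
    ?dST ?dTU ?andbF //=.
case: ifP => // _; rewrite setUA grinvUl // grinvUr // !exprD !mulrA; congr emono.
do 2 congr (_ * _); rewrite -mulrA (commr_sign (a S)) mulrA; congr (_ * _).
by rewrite -!exprD -addnA addnC.
Qed.

Lemma extoneE : extone = emono set0 1.
Proof. by apply/ffunP => S; rewrite !ffunE. Qed.

Lemma extmul1l : left_id extone extmul.
Proof.
move=> a; rewrite extoneE {1}(ext_sum_emono a) extmul_sumr [RHS]ext_sum_emono.
apply: eq_bigr => S _.
by rewrite extmul_emono -setI_eq0 set0I eqxx set0U grinv0l !mul1r.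
Qed.

Lemma extmul1r : right_id extone extmul.
Proof.
move=> a; rewrite extoneE {1}(ext_sum_emono a) extmul_suml [RHS]ext_sum_emono.
apply: eq_bigr => S _.
by rewrite extmul_emono -setI_eq0 setI0 eqxx setU0 grinv0r mulr1 mul1r.
Qed.

HB.instance Definition _ := GRing.Zmodule_isPzRing.Build (ext M m)
  extmulA extmul1l extmul1r extmulDl extmulDr.

Lemma emonoM S T x y : emono S x * emono T y =
  if [disjoint S & T] then emono (S :|: T) ((-1) ^+ grinv S T * x * y) else 0.
Proof. exact: extmul_emono. Qed.

Lemma emono_signM S n x : (-1) ^+ n * emono S x = emono S ((-1) ^+ n * x).
Proof.
by rewrite -[in LHS]signr_odd -[in RHS]signr_odd !mulr_sign; case: odd; rewrite ?raddfN.
Qed.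

Lemma emonoC S T x y : GRing.comm x y ->
  emono S x * emono T y = (-1) ^+ (#|S| * #|T|) * (emono T y * emono S x).
Proof.
move=> cxy; rewrite !emonoM disjoint_sym.
case: ifP => [dTS|_]; last by rewrite mulr0.
rewrite emono_signM setUC -!mulrA cxy; congr emono.
rewrite mulrA -exprD -grinvC; last by rewrite disjoint_sym.
by rewrite -signr_odd -[in RHS]signr_odd !oddD addbK.
Qed.

End ExtRing.

Lemma ext_oner_neq0 (M : nzRingType) m : 1 != 0 :> ext M m.
Proof.
by apply/eqP => /ffunP/(_ set0)/eqP; rewrite !ffunE eqxx oner_eq0.
Qed.

HB.instance Definition _ (M : nzRingType) m :=
  GRing.PzSemiRing_isNonZero.Build (ext M m) (ext_oner_neq0 M m).

Section ExtConstants.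
Variables (M : pzRingType) (m : nat).
Implicit Types (S : {set 'I_m}) (x y : M).

Definition extC x : ext M m := emono set0 x.

Lemma mul_extC_emono S x y : extC x * emono S y = emono S (x * y).
Proof. by rewrite emonoM -setI_eq0 set0I eqxx set0U grinv0l mul1r. Qed.

Lemma mul_emono_extC S x y : emono S x * extC y = emono S (x * y).
Proof. by rewrite emonoM -setI_eq0 setI0 eqxx setU0 grinv0r mul1r. Qed.

Fact extC_zmod_morphism : zmod_morphism extC.
Proof. exact: raddfB. Qed.

Fact extC_monoid_morphism : monoid_morphism extC.
Proof. by split=> [|x y]; rewrite ?mul_extC_emono //; apply/ffunP => S; rewrite !ffunE. Qed.

HB.instance Definition _ :=
  GRing.isZmodMorphism.Build M (ext M m) extC extC_zmod_morphism.
HB.instance Definition _ :=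
  GRing.isMonoidMorphism.Build M (ext M m) extC extC_monoid_morphism.

Lemma emonoE S x : emono S x = emono S 1 * extC x.
Proof. by rewrite mul_emono_extC mul1r. Qed.

Lemma comm_emono_extC S x : GRing.comm (emono S 1) (extC x).
Proof. by rewrite /GRing.comm mul_emono_extC mul_extC_emono mul1r mulr1. Qed.

Lemma comm_extC x (a : ext M m) : (forall S, GRing.comm x (a S)) -> GRing.comm (extC x) a.
Proof.
move=> cxa; rewrite (ext_sum_emono a); apply: commr_sum => S _.
by rewrite /GRing.comm mul_extC_emono mul_emono_extC cxa.
Qed.

Lemma extCME x (a : ext M m) S : (extC x * a) S = x * a S.
Proof.
rewrite {1}(ext_sum_emono a) mulr_sumr ext_sumE (bigD1 S) //= big1 => [|T neqTS].
  by rewrite mul_extC_emono ffunE eqxx addr0.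
by rewrite mul_extC_emono ffunE eq_sym (negPf neqTS).
Qed.

End ExtConstants.

Section ExtMap.
Variables (R R' : pzRingType) (f : {rmorphism R -> R'}) (m : nat).

Definition map_ext (a : ext R m) : ext R' m := [ffun T => f (a T)].

Fact map_ext_zmod_morphism : zmod_morphism map_ext.
Proof. by move=> a b; apply/ffunP => T; rewrite !ffunE rmorphB. Qed.

Fact map_ext_monoid_morphism : monoid_morphism map_ext.
Proof.
split=> [|a b]; apply/ffunP => U; rewrite !ffunE.
  by case: eqP; rewrite ?rmorph1 ?rmorph0.
rewrite rmorph_sum; apply: eq_bigr => S _; rewrite rmorph_sum; apply: eq_bigr => T _.
by case: ifP; rewrite ?rmorph0 // !rmorphM rmorph_sign !ffunE.
Qed.

HB.instance Definition _ :=
  GRing.isZmodMorphism.Build (ext R m) (ext R' m) map_ext map_ext_zmod_morphism.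
HB.instance Definition _ :=
  GRing.isMonoidMorphism.Build (ext R m) (ext R' m) map_ext map_ext_monoid_morphism.

End ExtMap.

Section ExtMatrix.
Variables (R : pzRingType) (m n : nat).

Definition ext_of_mx (x : 'M[ext R m]_n) : ext 'M[R]_n m :=
  [ffun T => \matrix_(i, j) x i j T].

Fact ext_of_mx_zmod_morphism : zmod_morphism ext_of_mx.
Proof. by move=> x y; apply/ffunP => T; apply/matrixP => i j; rewrite !(ffunE, mxE). Qed.

Fact ext_of_mx_monoid_morphism : monoid_morphism ext_of_mx.
Proof.
split=> [|x y]; apply/ffunP => U; apply/matrixP => i j.
  rewrite !(ffunE, mxE); case ij: (i == j); rewrite ?mulr1n ?mulr0n ffunE;
    by case: (U == set0); rewrite mxE ?ij.
rewrite !(ffunE, mxE) ext_sumE summxE; under eq_bigr do rewrite ffunE.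
rewrite exchange_big; apply: eq_bigr => S _.
rewrite summxE exchange_big; apply: eq_bigr => T _.
case: ifP => _; last by rewrite big1 ?mxE.
rewrite -signr_odd -[in RHS]signr_odd -[in RHS]mulrA mulr_sign.
transitivity ((-1) ^+ odd (grinv S T) * (ext_of_mx x S * ext_of_mx y T) i j).
  by rewrite mxE mulr_sumr; apply: eq_bigr => k _; rewrite !ffunE !mxE mulrA.
by rewrite mulr_sign; case: odd; rewrite ?mxE.
Qed.

HB.instance Definition _ := GRing.isZmodMorphism.Build _ _ ext_of_mx ext_of_mx_zmod_morphism.
HB.instance Definition _ := GRing.isMonoidMorphism.Build _ _ ext_of_mx ext_of_mx_monoid_morphism.

Lemma ext_of_mx_inj : injective ext_of_mx.
Proof.
move=> x y /ffunP eq_xy; apply/matrixP => i j; apply/ffunP => S.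
by move/matrixP: (eq_xy S) => /(_ i j); rewrite !ffunE !mxE.
Qed.

End ExtMatrix.

Section Order.
Variables (M : pzRingType) (m : nat).
Implicit Types (p q : nat) (a b : ext M m).

Definition order_geq p : {pred ext M m} :=
  fun a => [forall S : {set 'I_m}, (#|S| < p)%N ==> (a S == 0)].

Lemma order_geqP p a :
  reflect (forall S : {set 'I_m}, (#|S| < p)%N -> a S = 0) (a \in order_geq p).
Proof. by apply: (iffP 'forall_implyP) => ord_a S /ord_a/eqP. Qed.

Fact order_geq_zmod_closed p : zmod_closed (order_geq p).
Proof.
split=> [|a b /order_geqP ord_a /order_geqP ord_b]; apply/order_geqP => S ltS; rewrite !ffunE //.
by rewrite ord_a ?ord_b ?subr0.
Qed.

HB.instance Definition _ p := GRing.isZmodClosed.Build _ (order_geq p) (order_geq_zmod_closed p).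

Lemma order_geq0 a : a \in order_geq 0.
Proof. exact/order_geqP. Qed.

Lemma order_geq_emono (S : {set 'I_m}) (x : M) : emono S x \in order_geq #|S|.
Proof. by apply/order_geqP => T; rewrite ffunE; case: eqP => // ->; rewrite ltnn. Qed.

Lemma order_geqM p q a b :
  a \in order_geq p -> b \in order_geq q -> a * b \in order_geq (p + q).
Proof.
move=> /order_geqP ord_a /order_geqP ord_b; apply/order_geqP => U ltU.
rewrite ffunE big1 // => S _; rewrite big1 // => T _.
case: ifP => // /andP[/eqP dST /eqP defU]; move: ltU; rewrite -defU cardsU dST cards0 subn0.
have [/ord_a-> _|leS ltST] := ltnP #|S| p; first by rewrite mulr0 mul0r.
by rewrite (ord_b T) ?mulr0 // -(ltn_add2l p); apply: leq_ltn_trans ltST; rewrite leq_add2r.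
Qed.

Lemma order_geq_eq0 p a : (m < p)%N -> a \in order_geq p -> a = 0.
Proof.
move=> ltmp /order_geqP ord_a; apply/ffunP => S; rewrite ord_a ?ffunE //.
by apply: leq_ltn_trans ltmp; rewrite -[leqRHS]card_ord max_card.
Qed.

End Order.

(** * Torsion-free modules *)

Definition torsion_free (Z : zmodType) := forall (x : Z) k, x *+ k.+1 = 0 -> x = 0.

Lemma torsion_free_int : torsion_free int.
Proof. by move=> x k /eqP; rewrite Num.Theory.mulrn_eq0 => /eqP. Qed.

Lemma torsion_free_ext (M : pzRingType) m : torsion_free M -> torsion_free (ext M m).
Proof.
move=> tfM x k /ffunP kx0; apply/ffunP => S; rewrite ffunE.
by apply: (tfM _ k); rewrite -ffunMnE kx0 ffunE.
Qed.

Lemma torsion_free_mx (Z : zmodType) n p : torsion_free Z -> torsion_free 'M[Z]_(n, p).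
Proof.
move=> tfZ x k /matrixP kx0; apply/matrixP => i j; rewrite mxE.
by apply: (tfZ _ k); rewrite -mulmxnE kx0 mxE.
Qed.

Lemma torsion_free_eq_opp (Z : zmodType) (x : Z) : torsion_free Z -> x = - x -> x = 0.
Proof. by move=> tfZ eqxN; apply: (tfZ x 1%N); rewrite mulr2n {1}eqxN addNr. Qed.

Lemma poly_eq0_on_nat (V : nzRingType) (p : {poly V}) : torsion_free V ->
  (forall k : nat, p.[k%:R] = 0) -> p = 0.
Proof.
move=> tfV p0; have : forall k : nat, (0 <= k)%N -> p.[k%:R] = 0 by [].
have [s] := ubnP (size p); elim: s p {p0} 0%N => // s IHs p a les p0.
have /factor_theorem[q defp] : root p a%:R by apply/eqP/p0.
suff q0 : q = 0 by rewrite defp q0 mul0r.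
have [//|nz_q] := eqVneq q 0.
have szp : size p = (size q).+1 by rewrite defp size_Mmonic ?monicXsubC // size_XsubC addn2.
apply: (IHs q a.+1) => [|k ltak]; first by rewrite -szp.
apply: (tfV _ (k - a).-1); rewrite prednK ?subn_gt0 // -[RHS](p0 k (ltnW ltak)) defp.
have evalX : ('X - a%:R%:P).[k%:R] = (k - a)%:R :> V by rewrite hornerXsubC natrB // ltnW.
by rewrite hornerM_comm ?evalX ?mulr_natr // /comm_poly evalX; apply/commr_nat.
Qed.

(** * Traces of powers and nilpotency *)

Lemma deriv_prod (L : comNzRingType) (I : eqType) (r : seq I) (F : I -> {poly L}) : uniq r ->
  (\prod_(i <- r) F i)^`() =
  \sum_(i <- r) \prod_(j <- r) (if j == i then (F j)^`() else F j).
Proof.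
elim: r => [|i r IHr] /=; first by rewrite !big_nil derivC.
case/andP=> ir ur; rewrite !big_cons derivM IHr // eqxx; congr (_ * _ + _).
  by apply: eq_big_seq => j jr; case: eqP jr ir => // -> ->.
rewrite mulr_sumr; apply: eq_big_seq => k kr; rewrite big_cons.
by case: eqP kr ir => // -> ->.
Qed.

Lemma deriv_det (L : comNzRingType) n (P : 'M[{poly L}]_n) :
  (\det P)^`() = \tr (\adj P *m map_mx (fun p => p^`()) P).
Proof.
pose derive_row i := \matrix_(k, l) (if k == i then (P k l)^`() else P k l).
transitivity (\sum_i \det (derive_row i)).
  rewrite /determinant raddf_sum exchange_big; apply: eq_bigr => s _ /=.
  rewrite -mulr_sumr !mulr_sign.
  have derivE : (\prod_i P i (s i))^`() = \sum_i \prod_j derive_row i j (s j).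
    rewrite deriv_prod ?index_enum_uniq //; apply: eq_bigr => i _.
    by apply: eq_bigr => j _; rewrite mxE.
  by case: (odd_perm s); rewrite ?derivN derivE.
rewrite mxtrace_mulC; apply: eq_bigr => i _; rewrite (expand_det_row _ i) mxE.
apply: eq_bigr => j _; rewrite !mxE eqxx; congr (_ * (_ * \det _)).
by apply/matrixP => k l; rewrite !mxE eq_sym (negPf (neq_lift _ _)).
Qed.

(* Newton's identities in generating-function form: the derivative of the
   characteristic polynomial is the trace of the adjugate of X - T, whose coefficients
   are polynomials in T. *)
Section TraceNilpotency.
Variables (L : comNzRingType) (n : nat) (T : 'M[L]_n.+1).
Local Notation chi := (char_poly T).

Definition coef_adj_char k := map_mx (coefp k) (\adj (char_poly_mx T)).

Lemma coef_adj_char_rec k :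
  coef_adj_char k = coef_adj_char k.+1 * T + (chi`_k.+1)%:M.
Proof.
have /matrixP adjE := mul_adj_mx (char_poly_mx T).
apply/matrixP => i j; have := congr1 (coefp k.+1) (adjE i j).
rewrite /char_poly_mx mulmxBr scalar_mxC mul_scalar_mx !mxE /= coefMn => <-.
rewrite coefB coefXM coef_sum /= addrC.
rewrite (eq_bigr (fun l => coef_adj_char k.+1 i l * T l j)) ?subrK // => l _.
by rewrite [map_mx _ _ l j]mxE coefMC [coef_adj_char _ _ _]mxE.
Qed.

Lemma deriv_char_poly : chi^`() = \tr (\adj (char_poly_mx T)).
Proof.
rewrite deriv_det (_ : map_mx _ _ = 1%:M) ?mulmx1 //.
apply/matrixP => i j; rewrite !mxE derivB derivC subr0.
by case: eqP; rewrite ?derivX ?deriv0.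
Qed.

Hypotheses (tfL : torsion_free L) (trT : forall k, \tr (T ^+ k.+1) = 0).

Lemma coef_adj_char_eventually0 : exists K, forall k, (K <= k)%N -> coef_adj_char k = 0.
Proof.
exists (\max_i \max_j size (\adj (char_poly_mx T) i j)) => k leKk.
apply/matrixP => i j; rewrite [LHS]mxE [RHS]mxE /= nth_default //.
by apply: leq_trans leKk; apply: leq_trans (leq_bigmax i); apply: (leq_bigmax j).
Qed.

Lemma mxtrace_coef_adj_charMX_eq0 k j : \tr (coef_adj_char k * T ^+ j.+1) = 0.
Proof.
have [K adj0] := coef_adj_char_eventually0; have [s] := ubnP (K - k).
elim: s k j => // s IHs k j les; rewrite coef_adj_char_rec mulrDl -mulrA -exprS raddfD /=.
rewrite -[_%:M * _]/(_%:M *m _) mul_scalar_mx mxtraceZ trT mulr0 addr0.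
by have [/adj0->|ltkK] := leqP K k.+1; [rewrite mul0r mxtrace0 | apply: IHs; lia].
Qed.

Lemma coef_char_poly_eq0 k : (k < n)%N -> chi`_k.+1 = 0.
Proof.
move=> ltkn; apply: (tfL (k := (n - k.+1)%N)); rewrite subnSK // mulrnBr 1?ltnW //.
have : \tr (coef_adj_char k) = chi`_k.+1 *+ k.+1.
  by rewrite -coef_deriv deriv_char_poly coef_sum; apply: eq_bigr => i _; rewrite mxE.
rewrite coef_adj_char_rec raddfD /= -(expr1 T) mxtrace_coef_adj_charMX_eq0 add0r mxtrace_scalar.
by rewrite !mulrSr => /addIr->; rewrite subrr.
Qed.

Lemma nilpotent_of_mxtrace : T ^+ n.+1 = 0.
Proof.
have chiE : chi = 'X^(n.+1) + (chi`_0)%:P.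
  apply/polyP => -[|k]; rewrite coefD coefXn coefC ?add0r //= addr0 eqSS.
  case: ltngtP => [/coef_char_poly_eq0->|ltnk|->] //; last first.
    by have /monicP := char_poly_monic T; rewrite /lead_coef size_char_poly.
  by rewrite nth_default ?size_char_poly.
have TE : T ^+ n.+1 = - (chi`_0)%:M.
  apply/eqP; rewrite -addr_eq0 -[X in _ == X](Cayley_Hamilton T) [in eqbRHS]chiE.
  by rewrite rmorphD rmorphXn /= horner_mx_X horner_mx_C.
suff chi0 : chi`_0 = 0 by rewrite TE chi0 raddf0 oppr0.
apply: (tfL (k := n)); apply: oppr_inj.
by rewrite oppr0 -[RHS](trT n) TE raddfN /= mxtrace_scalar.
Qed.

End TraceNilpotency.

(** * Interleavings of a word with a power *)

(* [interleave A w s] is the sum of all words obtained by shuffling s letters A into w. *)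
Fixpoint interleave (V : pzRingType) (A : V) (w : seq V) (s : nat) : V :=
  if w is b :: w' then \sum_(i < s.+1) A ^+ i * b * interleave A w' (s - i) else A ^+ s.

Section Interleave.
Variable V : pzRingType.
Implicit Types (A B b : V) (w u : seq V).

Lemma interleave_cons0 A b w : interleave A (b :: w) 0 = b * interleave A w 0.
Proof. by rewrite /= big_ord1 mul1r. Qed.

Lemma interleave_consS A b w s :
  interleave A (b :: w) s.+1 = A * interleave A (b :: w) s + b * interleave A w s.+1.
Proof.
rewrite /= big_ord_recl mul1r subn0 addrC mulr_sumr; congr (_ + _).
by apply: eq_bigr => i _; rewrite exprS !mulrA.
Qed.

Lemma rmorph_interleave (V' : pzRingType) (f : {rmorphism V -> V'}) A w s :
  f (interleave A w s) = interleave (f A) (map f w) s.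
Proof.
elim: w s => [|b w IHw] s /=; first by rewrite rmorphXn.
by rewrite rmorph_sum; apply: eq_bigr => i _; rewrite !rmorphM rmorphXn IHw.
Qed.

Lemma interleave_sum_letter I (r : seq I) (P : pred I) (c y : I -> V) A u w s :
  (forall i, {in A :: u, forall x, GRing.comm (c i) x}) ->
  interleave A (u ++ (\sum_(i <- r | P i) c i * y i) :: w) s =
  \sum_(i <- r | P i) c i * interleave A (u ++ y i :: w) s.
Proof.
elim: u s => [|b u IHu] s comm_c /=.
  under [RHS]eq_bigr do rewrite mulr_sumr.
  rewrite exchange_big; apply: eq_bigr => k _ /=; rewrite mulr_sumr mulr_suml.
  apply: eq_bigr => i _; rewrite !mulrA (commrX k (comm_c i A _)) //.
  exact: mem_head.
under [RHS]eq_bigr do rewrite mulr_sumr.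
rewrite exchange_big; apply: eq_bigr => k _ /=; rewrite IHu => [|i x].
  rewrite mulr_sumr; apply: eq_bigr => i _; rewrite !mulrA; congr (_ * _).
  have comm_Ab : GRing.comm (c i) (A ^+ k * b).
    by apply: commrM; [apply/commrX/comm_c | apply/comm_c]; rewrite !inE eqxx ?orbT.
  by rewrite -[RHS]mulrA comm_Ab.
by rewrite inE => /predU1P[->|xu]; apply: comm_c; rewrite !inE ?eqxx ?xu ?orbT.
Qed.

Lemma exprD_interleave A B N :
  (A + B) ^+ N = \sum_(k < N.+1) interleave A (nseq k B) (N - k).
Proof.
pose u k s := interleave A (nseq k B) s; rewrite -[RHS]/(\sum_(k < N.+1) u k (N - k)%N).
have u0S s : u 0 s.+1 = A * u 0 s by apply: exprS.
have uS0 k : u k.+1 0 = B * u k 0 by apply: interleave_cons0.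
have uSS k s : u k.+1 s.+1 = A * u k.+1 s + B * u k s.+1 by apply: interleave_consS.
elim: N => [|N IHN]; first by rewrite big_ord1.
rewrite exprS IHN mulrDl [RHS]big_ord_recl u0S.
rewrite [in A * _]big_ord_recl mulrDr subn0 -addrA; congr (_ + _).
rewrite [in B * _]big_ord_recr [in RHS]big_ord_recr /= !subnn mulrDr uS0 addrA.
rewrite !mulr_sumr -big_split.
by congr (_ + _); apply: eq_bigr => k _; rewrite /= subSS -(subnSK (ltn_ord k)) uSS.
Qed.

Fixpoint insertions (b : V) w : seq (seq V) :=
  if w is a :: w' then (b :: w) :: [seq a :: u | u <- insertions b w'] else [:: [:: b]].

Lemma insertions_cons b a w :
  insertions b (a :: w) = (b :: a :: w) :: [seq a :: u | u <- insertions b w].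
Proof. by []. Qed.

End Interleave.

Section Polarization.
Variable V : nzRingType.
Implicit Types (A D : V) (w : seq V).
Local Notation pencil A D := (A%:P + D%:P * 'X).

Lemma coef1_pencilM A D (q : {poly V}) : (pencil A D * q)`_1 = A * q`_1 + D * q`_0.
Proof. by rewrite mulrDl -mulrA coefD !coefCM coefXM. Qed.

Lemma coef0_interleave_pencil A D w s :
  (interleave (pencil A D) (map polyC w) s)`_0 = interleave A w s.
Proof.
rewrite -[LHS]/(coefp 0 _) rmorph_interleave /= coefD coefC coefMX addr0 -map_comp.
by rewrite (eq_map (g := id)) ?map_id // => b /=; rewrite coefC.
Qed.

Lemma coef1_interleave_pencil0 A D w :
  (interleave (pencil A D) (map polyC w) 0)`_1 = 0.
Proof.
elim: w => [|b w IHw]; first by rewrite coef1.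
by rewrite map_cons interleave_cons0 coefCM IHw mulr0.
Qed.

Lemma coef1_interleave_pencilS A D w s :
  (interleave (pencil A D) (map polyC w) s.+1)`_1 =
  \sum_(u <- insertions D w) interleave A u s.
Proof.
elim: w s => [|b w IHw] s.
  rewrite big_seq1; elim: s => [|s IHs].
    by rewrite [interleave _ _ _]exprS coef1_pencilM !coefC mulr0 add0r interleave_cons0.
  rewrite [interleave _ _ _]exprS coef1_pencilM IHs interleave_consS.
  by rewrite (coef0_interleave_pencil A D [::]).
rewrite insertions_cons big_cons big_map; elim: s => [|s IHs].
  rewrite map_cons interleave_consS coefD coef1_pencilM -map_cons.
  rewrite coef1_interleave_pencil0 coef0_interleave_pencil coefCM IHw mulr0 add0r.
  rewrite [interleave A (D :: _) 0]interleave_cons0; congr (_ + _).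
  by rewrite mulr_sumr; apply: eq_bigr => u _; rewrite interleave_cons0.
rewrite map_cons (interleave_consS _ b%:P) coefD coef1_pencilM -map_cons.
rewrite IHs coef0_interleave_pencil coefCM IHw (interleave_consS A D (b :: w)).
under [in RHS]eq_bigr do rewrite interleave_consS.
by rewrite big_split /= -!mulr_sumr mulrDr addrACA addrA.
Qed.

Lemma horner_interleave_pencil A D w s (k : nat) :
  (interleave (pencil A D) (map polyC w) s).[k%:R] = interleave (A + D *+ k) w s.
Proof.
have comm_k : commr_rmorph (idfun : V -> V) k%:R by move=> x; apply/commr_sym/commr_nat.
have hornerE (q : {poly V}) : q.[k%:R] = horner_morph comm_k q.
  by rewrite /horner_morph map_poly_id.
rewrite hornerE rmorph_interleave rmorphD rmorphM /= !horner_morphC horner_morphX.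
rewrite mulr_natr -map_comp (eq_map (g := id)) ?map_id // => b /=.
by rewrite horner_morphC.
Qed.

(* The polynomial c * interleave (A + D X) w s.+1 vanishes at the integers, and the
   conclusion is about its coefficient of degree 1. *)
Lemma interleave_polarization c A D w s : torsion_free V ->
  (forall k : nat, c * interleave (A + D *+ k) w s.+1 = 0) ->
  c * (\sum_(u <- insertions D w) interleave A u s) = 0.
Proof.
move=> tfV c0; pose p := c%:P * interleave (pencil A D) (map polyC w) s.+1.
have p0 : p = 0.
  by apply: poly_eq0_on_nat => // k; rewrite /p hornerCM horner_interleave_pencil.
by rewrite -coef1_interleave_pencilS -coefCM -/p p0 coef0.
Qed.

End Polarization.

Lemma order_geq_interleave (M : pzRingType) m (a : ext M m) w s :
  {in w, forall b, b \in order_geq 1} -> interleave a w s \in order_geq (size w).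
Proof.
elim: w s => [|b w IHw] s w1 /=; first exact: order_geq0.
apply: rpred_sum => i _; apply: (order_geqM (p := 1)).
  by rewrite -[1%N]add0n; apply: order_geqM; [apply: order_geq0 | apply/w1/mem_head].
by apply: IHw => c cw; apply: w1; rewrite inE cw orbT.
Qed.

(** * Parity *)

Section Parity.
Variables (K : comNzRingType) (m : nat).
Implicit Types (a b : ext K m) (p q : bool).

Definition parity p : {pred ext K m} :=
  fun a => [forall S : {set 'I_m}, (odd #|S| != p) ==> (a S == 0)].

Lemma parityP p a :
  reflect (forall S : {set 'I_m}, odd #|S| != p -> a S = 0) (a \in parity p).
Proof. by apply: (iffP 'forall_implyP) => par_a S /par_a/eqP. Qed.

Fact parity_zmod_closed p : zmod_closed (parity p).
Proof.
split=> [|a b /parityP par_a /parityP par_b]; apply/parityP => S oddS; rewrite !ffunE //.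
by rewrite par_a ?par_b ?subr0.
Qed.

HB.instance Definition _ p := GRing.isZmodClosed.Build _ (parity p) (parity_zmod_closed p).

Lemma parity_emono (S : {set 'I_m}) (x : K) : emono S x \in parity (odd #|S|).
Proof. by apply/parityP => T; rewrite ffunE; case: (T =P S) => // ->; rewrite eqxx. Qed.

Lemma parity_extC (x : K) : extC m x \in parity false.
Proof. by have := parity_emono set0 x; rewrite cards0. Qed.

Lemma parity1 : 1 \in parity false.
Proof. exact: parity_extC. Qed.

Lemma parity_sum_emono p a : a \in parity p ->
  a = \sum_(S : {set 'I_m} | odd #|S| == p) emono S (a S).
Proof.
move/parityP=> par_a; rewrite {1}(ext_sum_emono a) (bigID (fun S : {set 'I_m} => odd #|S| == p)) /=.
by rewrite [X in _ + X]big1 ?addr0 // => S /par_a->; rewrite raddf0.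
Qed.

Lemma parityM p q a b : a \in parity p -> b \in parity q -> a * b \in parity (p (+) q).
Proof.
move=> /parity_sum_emono-> /parity_sum_emono->.
rewrite mulr_suml; apply: rpred_sum => S /eqP <-; rewrite mulr_sumr; apply: rpred_sum => T /eqP <-.
rewrite emonoM; case: ifP => [dST|_]; last exact: rpred0.
by rewrite -oddD -(cardsUI S T) (eqP (etrans (setI_eq0 S T) dST)) cards0 addn0 parity_emono.
Qed.

Lemma parityC p q a b : a \in parity p -> b \in parity q ->
  a * b = (-1) ^+ (p && q) * (b * a).
Proof.
move=> /parity_sum_emono-> /parity_sum_emono->.
rewrite mulr_suml [in RHS]mulr_sumr mulr_sumr; apply: eq_bigr => S /eqP oddS.
rewrite mulr_sumr mulr_suml mulr_sumr; apply: eq_bigr => T /eqP oddT.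
by rewrite emonoC; [rewrite -signr_odd oddM oddS oddT | apply: mulrC].
Qed.

Lemma comm_parity_false a b : a \in parity false -> GRing.comm a b.
Proof.
move=> par_a; rewrite (ext_sum_emono b); apply: commr_sum => S _.
by rewrite /GRing.comm (parityC par_a (parity_emono S _)) mul1r.
Qed.

Definition even_pred : {pred ext K m} := parity false.

Fact even_subring_closed : subring_closed even_pred.
Proof. by split=> [|a b|a b]; [apply: parity1 | apply: rpredB | apply: (@parityM false false)]. Qed.

HB.instance Definition _ := GRing.isSubringClosed.Build _ even_pred even_subring_closed.

Definition even_ext := {a : ext K m | a \in even_pred}.
HB.instance Definition _ := SubType.on even_ext.
HB.instance Definition _ := Choice.on even_ext.
HB.instance Definition _ := [SubChoice_isSubNzRing of even_ext by <:].

Fact even_ext_mulC : commutative (@GRing.mul even_ext).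
Proof. by move=> a b; apply: val_inj; rewrite !rmorphM; apply/comm_parity_false/valP. Qed.

HB.instance Definition _ := GRing.PzRing_hasCommutativeMul.Build even_ext even_ext_mulC.

Lemma torsion_free_even_ext : torsion_free K -> torsion_free even_ext.
Proof.
move=> tfK a k ka0; apply: val_inj; apply: (torsion_free_ext tfK (k := k)).
by rewrite -(rmorphMn val) /= ka0.
Qed.

End Parity.

Section ParityMatrix.
Variables (K : comNzRingType) (m n : nat).
Implicit Types (A B : 'M[ext K m]_n) (p q : bool).

Lemma mxOver_parity1 : 1 \is a @mxOver n n _ (@parity K m false).
Proof. by rewrite mxOver_scalar ?rpred0 ?parity1. Qed.

Lemma mxOver_parityM p q A B : A \is a mxOver (parity p) -> B \is a mxOver (parity q) ->
  A * B \is a mxOver (parity (p (+) q)).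
Proof.
move=> /mxOverP par_A /mxOverP par_B; apply/mxOverP => i j.
by rewrite mxE; apply: rpred_sum => k _; apply: parityM.
Qed.

Lemma mxOver_parityX k A : A \is a mxOver (parity true) -> A ^+ k \is a mxOver (parity (odd k)).
Proof.
move=> par_A; elim: k => [|k IHk]; first exact: mxOver_parity1.
by rewrite exprS; apply: (mxOver_parityM par_A IHk).
Qed.

Lemma mxOver_parity_scalarM p q (x : ext K m) A : x \in parity p -> A \is a mxOver (parity q) ->
  x%:M * A \is a mxOver (parity (p (+) q)).
Proof. by move=> par_x; apply: mxOver_parityM; rewrite mxOver_scalar ?rpred0. Qed.

Lemma mxtrace_parityC p q A B : A \is a mxOver (parity p) -> B \is a mxOver (parity q) ->
  \tr (A * B) = (-1) ^+ (p && q) * \tr (B * A).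
Proof.
move=> /mxOverP par_A /mxOverP par_B.
rewrite mulr_sumr [LHS](eq_bigr _ (fun i _ => mxE _ _ i i)) exchange_big.
apply: eq_bigr => i _; rewrite mxE mulr_sumr; apply: eq_bigr => j _; exact: parityC.
Qed.

Lemma scalar_parityC p q (x : ext K m) A : x \in parity p -> A \is a mxOver (parity q) ->
  A * x%:M = (-1) ^+ (p && q) * (x%:M * A).
Proof.
move=> par_x /mxOverP par_A; rewrite mulr_sign -mulmxE mul_scalar_mx; apply/matrixP => i j.
have -> : (if p && q then - (x *: A) else x *: A) i j = (-1) ^+ (p && q) * (x * A i j).
  by rewrite mulr_sign; case: (p && q); rewrite !mxE.
rewrite andbC -(parityC (par_A i j) par_x) mxE (bigD1 j) //= big1 ?addr0 => [|k /negPf neqkj].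
  by rewrite mxE eqxx.
by rewrite mxE neqkj mulr0.
Qed.

End ParityMatrix.

(** * Sums over a triangle of exponents *)

Section TriangleSums.
Variable Z : zmodType.
Implicit Types (f g : nat -> nat -> nat -> Z) (s k : nat).

Definition line_sum s f k := \sum_(i < (s - k).+1) f i (s - k - i)%N k.
Definition plane_sum s f := \sum_(k < s.+1) line_sum s f k.

Definition rot3 f i j k := f j k i.

Lemma eq_line_sum s f g k : (k <= s)%N ->
  (forall i j, (i + j + k = s)%N -> f i j k = g i j k) -> line_sum s f k = line_sum s g k.
Proof.
by move=> leks eq_fg; apply: eq_bigr => i _; apply: eq_fg; have := ltn_ord i; lia.
Qed.

Lemma eq_plane_sum s f g :
  (forall i j k, (i + j + k = s)%N -> f i j k = g i j k) -> plane_sum s f = plane_sum s g.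
Proof.
by move=> eq_fg; apply: eq_bigr => k _; apply: eq_line_sum => [|i j /eq_fg //]; rewrite -ltnS.
Qed.

Lemma line_sum_rev s f k : line_sum s f k = \sum_(i < (s - k).+1) f (s - k - i)%N i k.
Proof.
rewrite /line_sum (reindex_inj rev_ord_inj); apply: eq_bigr => i _ /=.
by rewrite subSS subKn // -ltnS.
Qed.

Lemma exchange_big_triangle s (F : nat -> nat -> Z) :
  \sum_(k < s.+1) \sum_(i < (s - k).+1) F k i = \sum_(i < s.+1) \sum_(k < (s - i).+1) F k i.
Proof.
have widen (G : nat -> Z) k :
    \sum_(i < (s - k).+1) G i = \sum_(i < s.+1 | (i < (s - k).+1)%N) G i.
  by rewrite -big_ord_widen // ltnS leq_subr.
under eq_bigr do rewrite widen; under [RHS]eq_bigr do rewrite (widen (F^~ _)).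
rewrite (exchange_big_dep xpredT) //=; apply: eq_bigr => i _; apply: eq_bigl => k.
by have := ltn_ord i; have := ltn_ord k; lia.
Qed.

Lemma plane_sum_rot3 s f : plane_sum s (rot3 f) = plane_sum s f.
Proof.
rewrite [LHS](exchange_big_triangle s (fun k i => f (s - k - i)%N k i)).
apply: eq_bigr => k _; rewrite line_sum_rev.
by apply: eq_bigr => i _; rewrite subnAC.
Qed.

Lemma plane_sumD s f g :
  plane_sum s (fun i j k => f i j k + g i j k) = plane_sum s f + plane_sum s g.
Proof. by rewrite -big_split; apply: eq_bigr => k _; rewrite -big_split. Qed.

Lemma plane_sumMn s f c : plane_sum s (fun i j k => f i j k *+ c) = plane_sum s f *+ c.
Proof. by rewrite -sumrMnl; apply: eq_bigr => k _; rewrite -sumrMnl. Qed.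

Definition lines_vanish s (P : pred nat) f := forall k, P k ->
  [/\ line_sum s f k = 0, line_sum s (rot3 f) k = 0 & line_sum s (rot3 (rot3 f)) k = 0].

Lemma lines_vanish_cyclic (T : Type) (Q : T -> Prop) s (P : pred nat)
    (g : T -> T -> T -> nat -> nat -> nat -> Z) :
  (forall k, P k -> (k <= s)%N) ->
  (forall x y z, Q x -> Q y -> Q z -> forall k, P k -> line_sum s (g x y z) k = 0) ->
  (forall x y z, Q x -> Q y -> Q z ->
     forall i j k, (i + j + k = s)%N -> g x y z i j k = g y z x j k i) ->
  forall x y z, Q x -> Q y -> Q z -> lines_vanish s P (g x y z).
Proof.
move=> lePs lines0 cyclic_g x y z Qx Qy Qz k Pk; split; first exact: lines0.
  rewrite -(lines0 z x y Qz Qx Qy k Pk); apply: eq_line_sum => [|i j ijk]; first exact: lePs.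
  by rewrite /rot3 [RHS]cyclic_g.
rewrite -(lines0 y z x Qy Qz Qx k Pk); apply: eq_line_sum => [|i j ijk]; first exact: lePs.
by rewrite /rot3 [LHS]cyclic_g // -ijk -addnA addnC.
Qed.

Lemma plane_sum_weights_eq0 s P f (w : nat -> nat) : lines_vanish s P f ->
  (forall k, ~~ P k -> w k = 0%N) ->
  plane_sum s (fun i j k => f i j k *+ (w i + w j + w k)) = 0.
Proof.
move=> lines0 w0; have weight0 g :
    (forall k, P k -> line_sum s g k = 0) -> plane_sum s (fun i j k => g i j k *+ w k) = 0.
  move=> g0; apply: big1 => k _; rewrite /line_sum sumrMnl -/(line_sum s g k).
  by have [/g0->|/w0->] := boolP (P k); rewrite ?mul0rn ?mulr0n.
rewrite (@eq_plane_sum _ _ (fun i j k => (f i j k *+ w i + f i j k *+ w j) + f i j k *+ w k)).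
  rewrite !plane_sumD -[X in X + _ + _]plane_sum_rot3 -[X in X + _ + _]plane_sum_rot3.
  rewrite -[X in _ + X + _]plane_sum_rot3 !weight0 ?addr0 // => k /lines0[] //.
by move=> i j k _; rewrite !mulrnDr.
Qed.

Definition even_part f i j k := if [|| odd i, odd j | odd k] then 0 else f i j k.

(* For exponents below 2 * d adding up to 4 * d - 4, the weights d - 1 - i./2 add up to
   d - 1 if all three are even, and to d if two of them are odd. *)
Lemma plane_sum_eq0 d f : torsion_free Z -> (2 <= d)%N ->
  (forall i j k, ~~ [&& i < 2 * d, j < 2 * d & k < 2 * d]%N -> f i j k = 0) ->
  lines_vanish (4 * d - 4) (fun k => k.+2 < 2 * d)%N f ->
  lines_vanish (4 * d - 4) (fun k => k.+2 < 2 * d)%N (even_part f) ->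
  plane_sum (4 * d - 4) f = 0.
Proof.
move=> tfZ d_gt1 f0 lines0 even_lines0; pose w k := (d.-1 - k./2)%N.
have w0 k : ~~ (k.+2 < 2 * d)%N -> w k = 0%N by rewrite /w; lia.
have dS : d = d.-1.+1 by lia.
have weightE i j k : (i + j + k = 4 * d - 4)%N ->
    f i j k *+ (w i + w j + w k) = f i j k *+ (d - ~~ [|| odd i, odd j | odd k]).
  have [/and3P[lti ltj ltk] ijk|/f0->] := boolP [&& i < 2 * d, j < 2 * d & k < 2 * d]%N.
    by congr (_ *+ _); rewrite /w; lia.
  by rewrite !mul0rn.
have even0 : plane_sum (4 * d - 4) (even_part f) = 0.
  apply: (tfZ _ d.-2); rewrite -plane_sumMn -[RHS](plane_sum_weights_eq0 even_lines0 w0).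
  apply: eq_plane_sum => i j k /weightE; rewrite /even_part.
  by case: ifP => _; rewrite ?mul0rn // subn1 => ->; congr (_ *+ _); lia.
apply: (tfZ _ d.-1); rewrite -dS -plane_sumMn -[RHS]addr0 -[X in _ = _ + X]even0.
rewrite -[X in X + _](plane_sum_weights_eq0 lines0 w0) -plane_sumD.
apply: eq_plane_sum => i j k /weightE->; rewrite /even_part.
by case: ifP => _; rewrite ?subn0 ?addr0 // subn1 -mulrSr -dS.
Qed.

End TriangleSums.

(** * Odd matrices *)

Lemma mxtrace_delta_mxM (R : pzRingType) n (A : 'M[R]_n) i j : \tr (delta_mx j i *m A) = A i j.
Proof.
rewrite /mxtrace (bigD1 j) //= big1 ?addr0 => [|k /negPf neqkj].
  rewrite mxE (bigD1 i) //= big1 ?addr0 => [|l /negPf neqli]; first by rewrite mxE !eqxx mul1r.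
  by rewrite mxE neqli andbF mul0r.
by rewrite mxE big1 // => l _; rewrite mxE neqkj mul0r.
Qed.

Section OddMatrices.
Variables (K : comNzRingType) (m n : nat).
Hypothesis tfK : torsion_free K.
Local Notation Lam := (ext K m).
Local Notation d := n.+1.
Local Notation odd_mx := (mxOver (parity true)).
Implicit Types (A B C D : 'M[Lam]_d) (eta zeta : Lam).

(* Rosset's argument: the entries of A ^+ 2 commute, and the trace of an even power of A is
   minus itself because the entries of A anticommute. *)
Lemma odd_mx_nilpotent A : A \is a odd_mx -> A ^+ (2 * d) = 0.
Proof.
move=> odd_A; have /mxOverP evenA2 := mxOver_parityX 2 odd_A.
pose T : 'M[even_ext K m]_d := \matrix_(i, j) insubd 0 ((A ^+ 2) i j).
have TE : map_mx val T = A ^+ 2.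
  by apply/matrixP => i j; rewrite mxE [T i j]mxE insubdK //; apply: evenA2.
have TX k : map_mx val (T ^+ k) = A ^+ (2 * k) by rewrite rmorphXn /= TE exprM.
rewrite -TX nilpotent_of_mxtrace ?map_mx0 //; first exact: torsion_free_even_ext.
move=> k; apply: val_inj; rewrite -trace_map_mx TX mulnS.
apply: (torsion_free_eq_opp (torsion_free_ext tfK)); rewrite exprS.
rewrite [LHS](mxtrace_parityC odd_A (mxOver_parityX _ odd_A)) -exprSr -exprS /= oddM /=.
by rewrite expr1 mulN1r.
Qed.

Lemma odd_mx_exp_eq0 A s : A \is a odd_mx -> (2 * d <= s)%N -> A ^+ s = 0.
Proof. by move=> odd_A le_2ds; rewrite -(subnK le_2ds) exprD odd_mx_nilpotent ?mulr0. Qed.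

Lemma odd_mx_interleave1_eq0 A B s : A \is a odd_mx -> B \is a odd_mx -> (2 * d <= s.+1)%N ->
  interleave A [:: B] s = 0.
Proof.
move=> odd_A odd_B le_2ds.
have tfM : torsion_free 'M[Lam]_d by apply/torsion_free_mx/torsion_free_ext.
have := @interleave_polarization _ 1 A B [::] s tfM; rewrite mul1r big_seq1; apply=> k.
by rewrite mul1r; apply: odd_mx_exp_eq0; rewrite ?rpredD ?rpredMn.
Qed.

Lemma odd_mx_signed_interleave_eq0 eta A W s : eta \in parity true ->
  A \is a odd_mx -> W \is a mxOver (parity false) -> (2 * d <= s.+1)%N ->
  eta%:M * (\sum_(i < s.+1) (-1) ^+ i * (A ^+ i * W * A ^+ (s - i))) = 0.
Proof.
move=> odd_eta odd_A even_W le_2ds.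
rewrite -[RHS](odd_mx_interleave1_eq0 odd_A (mxOver_parity_scalarM odd_eta even_W) le_2ds).
rewrite mulr_sumr.
apply: eq_bigr => i _; rewrite [A ^+ i * (_ * W)]mulrA.
rewrite (scalar_parityC odd_eta (mxOver_parityX i odd_A)).
by rewrite /= signr_odd mulrA (commr_sign eta%:M) -!mulrA.
Qed.

Definition trace_word A D B C i j k : Lam := \tr (D * A ^+ i * B * A ^+ j * C * A ^+ k).

Section CyclicWords.
Variables (A : 'M[Lam]_d) (eta : Lam).
Hypotheses (odd_A : A \is a odd_mx) (odd_eta : eta \in parity true) (d_gt1 : (2 <= d)%N).
Local Notation word D B C := (fun i j k => eta * trace_word A D B C i j k).
Local Notation s := (4 * d - 4)%N.

Lemma trace_word_rot3 D B C i j k :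
  D \is a odd_mx -> B \is a odd_mx -> C \is a odd_mx -> ~~ odd (i + j + k) ->
  trace_word A D B C i j k = trace_word A B C D j k i.
Proof.
move=> odd_D odd_B odd_C even_ijk; rewrite /trace_word -!(mulrA (D * A ^+ i)).
have parityAX k' : A ^+ k' \is a mxOver (parity (odd k')) := mxOver_parityX k' odd_A.
have parityDA := mxOver_parityM odd_D (parityAX i).
have parityBC :=
  mxOver_parityM (mxOver_parityM (mxOver_parityM odd_B (parityAX j)) odd_C) (parityAX k).
rewrite (mxtrace_parityC parityDA parityBC) -signr_odd (_ : odd _ = false) ?mul1r ?mulrA //.
by move: even_ijk; rewrite !oddD; case: (odd i); case: (odd j); case: (odd k).
Qed.

Lemma line_sum_word_eq0 D B C k : D \is a odd_mx -> B \is a odd_mx -> C \is a odd_mx ->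
  (k.+2 < 2 * d)%N -> line_sum s (word D B C) k = 0.
Proof.
move=> odd_D odd_B odd_C lt_k; rewrite /line_sum -mulr_sumr.
have le_2ds : (2 * d <= (s - k).+1)%N by lia.
have <- : \tr (D * interleave A [:: B] (s - k) * C * A ^+ k) =
    \sum_(i < (s - k).+1) trace_word A D B C i (s - k - i) k.
  rewrite [D * _]mulr_sumr !mulr_suml raddf_sum; apply: eq_bigr => i _.
  by rewrite /trace_word !mulrA.
by rewrite odd_mx_interleave1_eq0 // mulr0 !mul0r mxtrace0 mulr0.
Qed.

Lemma signed_line_sum_word_eq0 D B C k : D \is a odd_mx -> B \is a odd_mx -> C \is a odd_mx ->
  (k.+2 < 2 * d)%N -> ~~ odd k ->
  line_sum s (fun i j k => (-1) ^+ i * word D B C i j k) k = 0.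
Proof.
move=> odd_D odd_B odd_C lt_k even_k; rewrite line_sum_rev; set r := (s - k)%N.
have parityAX k' : A ^+ k' \is a mxOver (parity (odd k')) := mxOver_parityX k' odd_A.
have even_W : C * A ^+ k * D \is a mxOver (parity false).
  by have := mxOver_parityM (mxOver_parityM odd_C (parityAX k)) odd_D; rewrite (negPf even_k).
have le_2ds : (2 * d <= r.+1)%N by rewrite /r; lia.
have := congr1 (fun X => \tr (X * B)) (odd_mx_signed_interleave_eq0 odd_eta odd_A even_W le_2ds).
rewrite mul0r mxtrace0 -mulrA -[_%:M * _]/(_%:M *m _) mul_scalar_mx mxtraceZ => trace0.
rewrite -[RHS]trace0 mulr_suml raddf_sum mulr_sumr; apply: eq_bigr => i _ /=.
have odd_ri : odd (r - i) = odd i by have := ltn_ord i; rewrite /r; lia.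
rewrite -signr_odd odd_ri signr_odd -(mulrA _ _ B) raddfMsign.
rewrite [RHS]mulrA (commr_sign eta) -[RHS]mulrA.
have parityDB := mxOver_parityM (mxOver_parityM odd_D (parityAX (r - i)%N)) odd_B.
have parityCA := mxOver_parityM (mxOver_parityM (parityAX i) odd_C) (parityAX k).
have := mxtrace_parityC parityDB parityCA; rewrite odd_ri (negPf even_k) /trace_word !mulrA => ->.
by rewrite (_ : _ && _ = false) ?mul1r //; case: (odd i).
Qed.

Lemma line_sum_even_word_eq0 D B C k : D \is a odd_mx -> B \is a odd_mx -> C \is a odd_mx ->
  (k.+2 < 2 * d)%N -> line_sum s (even_part (word D B C)) k = 0.
Proof.
move=> odd_D odd_B odd_C lt_k; have [odd_k|even_k] := boolP (odd k).
  by apply: big1 => i _; rewrite /even_part odd_k !orbT.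
apply: (torsion_free_ext tfK (k := 1)).
rewrite -[RHS]addr0 -[X in _ = X + _](line_sum_word_eq0 odd_D odd_B odd_C lt_k).
rewrite -[X in _ = _ + X](signed_line_sum_word_eq0 odd_D odd_B odd_C lt_k even_k).
rewrite -big_split -sumrMnl.
apply: eq_bigr => i _ /=; rewrite /even_part (negPf even_k) orbF.
have -> : odd (s - k - i) = odd i by have := ltn_ord i; lia.
by rewrite orbb -signr_odd; case: (odd i); rewrite ?mulN1r ?subrr ?mul0rn // mul1r -mulr2n.
Qed.

Lemma plane_sum_word_eq0 D B C : D \is a odd_mx -> B \is a odd_mx -> C \is a odd_mx ->
  plane_sum s (word D B C) = 0.
Proof.
move=> odd_D odd_B odd_C.
have word_rot3 D' B' C' : D' \is a odd_mx -> B' \is a odd_mx -> C' \is a odd_mx ->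
    forall i j k, (i + j + k = s)%N -> word D' B' C' i j k = word B' C' D' j k i.
  by move=> odd_D' odd_B' odd_C' i j k ijk; rewrite trace_word_rot3 // ijk; lia.
have le_lines k : (k.+2 < 2 * d)%N -> (k <= s)%N by lia.
apply: plane_sum_eq0 => //; first exact: torsion_free_ext.
- move=> i j k; rewrite /trace_word !negb_and -!leqNgt.
  by case/or3P=> /(odd_mx_exp_eq0 odd_A)->; rewrite !(mulr0, mul0r) mxtrace0 mulr0.
- apply: (lines_vanish_cyclic (Q := fun X => X \is a odd_mx) (g := fun D B C => word D B C)) => //.
  by move=> *; apply: line_sum_word_eq0.
apply: (lines_vanish_cyclic (Q := fun X => X \is a odd_mx)
  (g := fun D B C => even_part (word D B C))) => //.
  by move=> *; apply: line_sum_even_word_eq0.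
move=> X X' X'' odd_X odd_X' odd_X'' i j k ijk.
by rewrite /even_part /= orbC -orbA word_rot3.
Qed.

End CyclicWords.

Lemma mxtrace_mul_interleave2 A D B C s :
  \tr (D * interleave A [:: B; C] s) = plane_sum s (trace_word A D B C).
Proof.
rewrite -plane_sum_rot3 -plane_sum_rot3 mulr_sumr raddf_sum; apply: eq_bigr => i _.
rewrite [A ^+ i * _ * _]mulr_sumr mulr_sumr raddf_sum; apply: eq_bigr => j _.
by rewrite /rot3 /trace_word !mulrA.
Qed.

Lemma odd_mx_interleave2_eq0 eta zeta A B C : eta \in parity true -> zeta \in parity true ->
  A \is a odd_mx -> B \is a odd_mx -> C \is a odd_mx -> (2 <= d)%N ->
  (eta * zeta)%:M * interleave A [:: B; C] (4 * d - 4) = 0.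
Proof.
move=> odd_eta odd_zeta odd_A odd_B odd_C d_gt1; apply/matrixP => r c.
have even_delta : delta_mx c r \is a @mxOver d d Lam (parity false).
  by apply/mxOverP => i j; rewrite mxE; case: (_ && _); rewrite ?parity1 ?rpred0.
have odd_D := mxOver_parity_scalarM odd_zeta even_delta.
rewrite [RHS]mxE -[RHS](plane_sum_word_eq0 odd_A odd_eta d_gt1 odd_D odd_B odd_C).
transitivity (eta * \tr (zeta%:M * delta_mx c r * interleave A [:: B; C] (4 * d - 4))).
  by rewrite -!mulmxE -mulmxA !mul_scalar_mx mxtraceZ mxtrace_delta_mxM mxE mulrA.
rewrite mxtrace_mul_interleave2.
by rewrite /plane_sum mulr_sumr; apply: eq_bigr => k _; rewrite mulr_sumr.
Qed.

Lemma odd_mx_interleave_insertions_eq0 eta zeta A B C D :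
  eta \in parity true -> zeta \in parity true -> A \is a odd_mx ->
  B \is a odd_mx -> C \is a odd_mx -> D \is a odd_mx -> (2 <= d)%N ->
  (eta * zeta)%:M * (\sum_(u <- insertions D [:: B; C]) interleave A u (4 * d - 5)) = 0.
Proof.
move=> odd_eta odd_zeta odd_A odd_B odd_C odd_D d_gt1.
apply: interleave_polarization => [|k]; first exact/torsion_free_mx/torsion_free_ext.
rewrite (_ : (4 * d - 5).+1 = 4 * d - 4)%N; last by lia.
by rewrite odd_mx_interleave2_eq0 ?rpredD ?rpredMn.
Qed.

End OddMatrices.

(** * Powers of an element with few exterior generators *)

Lemma alternating_shuffle_sum_eq0 (I : finType) (W : pzRingType) (P : pred I)
    (c h : I -> I -> I -> W) :
  (forall i j k, P i -> P j -> P k -> c j k i = - c i k j) ->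
  (forall i j k, h k i j + h i k j + h i j k = 0) ->
  \sum_(i | P i) \sum_(j | P j) \sum_(k | P k) c i j k * h i j k = 0.
Proof.
move=> c_swap h_shuffle; pose sum3 (F : I -> I -> I -> W) :=
  \sum_(i | P i) \sum_(j | P j) \sum_(k | P k) F i j k.
have rotE : sum3 (fun i j k => c i j k * h k i j) = sum3 (fun i j k => c j k i * h i j k).
  by rewrite /sum3; under eq_bigr do rewrite exchange_big /=; rewrite exchange_big.
have swapE : sum3 (fun i j k => c i j k * h i k j) = sum3 (fun i j k => c i k j * h i j k).
  by apply: eq_bigr => i _; rewrite exchange_big.
have opp : sum3 (fun i j k => c j k i * h i j k) = - sum3 (fun i j k => c i k j * h i j k).
  rewrite /sum3 -sumrN; apply: eq_bigr => i Pi; rewrite -sumrN; apply: eq_bigr => j Pj.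
  by rewrite -sumrN; apply: eq_bigr => k Pk; rewrite c_swap ?mulNr.
rewrite -[LHS]add0r -{1}[0](addNr (sum3 (fun i j k => c i k j * h i j k))) -opp -rotE -swapE.
rewrite /sum3 -!big_split big1 // => i _; rewrite -!big_split big1 // => j _.
by rewrite -!big_split big1 // => k _ /=; rewrite -!mulrDr h_shuffle mulr0.
Qed.

Lemma mul_emono3_swap (M : pzRingType) m (S T U : {set 'I_m})
    (v := fun S => emono S 1 : ext M m) : (m <= 3)%N ->
  S != set0 -> T != set0 -> U != set0 -> v T * v U * v S = - (v S * v U * v T).
Proof.
move=> m_le3; rewrite -!card_gt0 => S0 T0 U0.
have mul3_eq0 (A B C : {set 'I_m}) : (m < #|A| + #|B| + #|C|)%N -> v A * v B * v C = 0.
  by move/order_geq_eq0; apply; do 2?apply: order_geqM; apply: order_geq_emono.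
have [ltm|lem] := ltnP m (#|S| + #|T| + #|U|); first by rewrite !mul3_eq0 ?oppr0 //; lia.
have [S1 T1 U1] : [/\ #|S| = 1, #|T| = 1 & #|U| = 1]%N by split; lia.
have anticomm (A B : {set 'I_m}) : #|A| = 1%N -> #|B| = 1%N -> v A * v B = - (v B * v A).
  by move=> cardA cardB; rewrite /v emonoC ?cardA ?cardB ?mulN1r //; apply: commr1.
rewrite -[LHS]mulrA (anticomm U S) // mulrN mulrA (anticomm T S) // mulNr opprK.
by rewrite -[LHS]mulrA (anticomm T U) // mulrN mulrA.
Qed.

Section ExteriorPower.
Variables (V : pzRingType) (m : nat) (Y : ext V m).
Implicit Types (S T U : {set 'I_m}) (c : V) (u : seq V).
Local Notation a := (Y set0).
Local Notation v S := (emono S 1 : ext V m).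

Definition augmentation : ext V m := \sum_(S : {set 'I_m} | S != set0) v S * extC m (Y S).
Local Notation b := augmentation.

Lemma ext_split_augmentation : Y = extC m a + b.
Proof.
rewrite [LHS]ext_sum_emono (bigD1 set0) //=; congr (_ + _).
by apply: eq_bigr => S _; rewrite emonoE.
Qed.

Lemma order_geq_augmentation : b \in order_geq 1.
Proof.
apply: rpred_sum => S; rewrite -card_gt0 => S0; apply/order_geqP => T ltT.
rewrite mul_emono_extC ffunE; case: eqP ltT => // ->; lia.
Qed.

Definition mixed_interleave c u k s :=
  extC m c * interleave (extC m a) (map (extC m) u ++ nseq k b) s.

Lemma mixed_interleave0 c u s : mixed_interleave c u 0 s = extC m (c * interleave a u s).
Proof. by rewrite /mixed_interleave cats0 -rmorph_interleave -rmorphM. Qed.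

Lemma mixed_interleaveS c u k s : mixed_interleave c u k.+1 s =
  \sum_(S : {set 'I_m} | S != set0) v S * mixed_interleave c (rcons u (Y S)) k s.
Proof.
rewrite /mixed_interleave interleave_sum_letter => [|S x].
  rewrite mulr_sumr; apply: eq_bigr => S _.
  by rewrite map_rcons cat_rcons !mulrA comm_emono_extC.
by rewrite inE => /predU1P[->|/mapP[y _ ->]]; apply: comm_emono_extC.
Qed.

Lemma ext_exp_expansion c p N : (m <= p)%N -> extC m c * Y ^+ (p + N) =
  \sum_(k < p.+1) mixed_interleave c [::] k (p + N - k).
Proof.
move=> lemp; rewrite ext_split_augmentation exprD_interleave -[(p + N).+1]/(p.+1 + N)%N.
rewrite big_split_ord /= [X in _ + X]big1 ?addr0 => [|k _]; first by rewrite mulr_sumr.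
apply: (order_geq_eq0 (p := p.+1 + k)); first by lia.
rewrite -[X in order_geq X](size_nseq _ b); apply: order_geq_interleave => x.
by rewrite mem_nseq => /andP[_ /eqP->]; apply: order_geq_augmentation.
Qed.

Lemma ext_exp_eq0 c N : (m <= 3)%N ->
  c * a ^+ N.+3 = 0 ->
  (forall S, c * interleave a [:: Y S] N.+2 = 0) ->
  (forall S T, c * interleave a [:: Y S; Y T] N.+1 = 0) ->
  (forall S T U, c * (\sum_(u <- insertions (Y U) [:: Y S; Y T]) interleave a u N) = 0) ->
  extC m c * Y ^+ N.+3 = 0.
Proof.
move=> m_le3 deg0 deg1 deg2 deg3.
rewrite -[N.+3]/(3 + N)%N (ext_exp_expansion c N m_le3).
rewrite !big_ord_recl big_ord0 addr0 /= !subSS !subn0.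
rewrite mixed_interleave0 /= deg0 raddf0 add0r.
rewrite mixed_interleaveS big1 => [|S _]; last first.
  by rewrite mixed_interleave0 /= deg1 raddf0 mulr0.
rewrite add0r mixed_interleaveS big1 => [|S _]; last first.
  rewrite mixed_interleaveS big1 ?mulr0 // => T _.
  by rewrite mixed_interleave0 /= deg2 raddf0 mulr0.
rewrite add0r -[X in mixed_interleave _ _ X]/3%N.
pose h S T U := extC m (c * interleave a [:: Y S; Y T; Y U] N).
transitivity (\sum_(S | S != set0) \sum_(T | T != set0) \sum_(U | U != set0)
    v S * v T * v U * h S T U).
  rewrite mixed_interleaveS; apply: eq_bigr => S _.
  rewrite mixed_interleaveS mulr_sumr; apply: eq_bigr => T _.
  rewrite mixed_interleaveS !mulr_sumr; apply: eq_bigr => U _.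
  by rewrite mixed_interleave0 !mulrA.
apply: alternating_shuffle_sum_eq0 => [S T U|S T U]; first exact: mul_emono3_swap.
rewrite /h -!raddfD -!mulrDr -[RHS](raddf0 (extC m)) -(deg3 S T U) !insertions_cons.
by rewrite !big_cons big_nil addr0 addrA.
Qed.

End ExteriorPower.

Lemma odd_ext_exp_eq0 (K : comNzRingType) k m n (eta zeta : ext K k)
    (Y : ext 'M[ext K k]_n.+1 m) :
  torsion_free K -> eta \in parity true -> zeta \in parity true ->
  (forall S, Y S \is a mxOver (parity true)) -> (1 <= n)%N -> (m <= 3)%N ->
  extC m (eta * zeta)%:M * Y ^+ (4 * n.+1 - 2) = 0.
Proof.
move=> tfK odd_eta odd_zeta odd_Y n_gt0 m_le3.
rewrite (_ : 4 * n.+1 - 2 = (4 * n.+1 - 5).+3)%N; last by lia.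
apply: ext_exp_eq0 => // [|S|S T|S T U].
- by rewrite odd_mx_exp_eq0 ?mulr0 //; lia.
- by rewrite odd_mx_interleave1_eq0 ?mulr0 //; lia.
- rewrite (_ : (4 * n.+1 - 5).+1 = 4 * n.+1 - 4)%N; last by lia.
  exact: odd_mx_interleave2_eq0.
exact: odd_mx_interleave_insertions_eq0.
Qed.

(** * Standard polynomials *)

Definition standard (W : pzRingType) k (y : 'I_k -> W) : W :=
  \sum_(s : 'S_k) (-1) ^+ s * \prod_(i < k) y (s i).

Lemma std_polyE (R : comPzRingType) m n k (x : 'I_k -> 'M[grass R m]_n) :
  std_poly x = standard (x : 'I_k -> 'M[ext R m]_n).
Proof.
have mulE (A B : 'M[ext R m]_n) : grmxmul A B = A * B.
  by apply/matrixP => i j; rewrite !mxE.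
have oneE : grmx1 R m n = (1 : 'M[ext R m]_n).
  by apply/matrixP => i j; rewrite !mxE; case: (i == j).
have prodE (l : seq 'M[ext R m]_n) : grmxprod l = \prod_(A <- l) A.
  by elim: l => [|A l IHl] /=; rewrite ?big_nil ?big_cons ?oneE // mulE -IHl.
apply: eq_bigr => s _; have -> : grmxprod [seq x (s i) | i <- enum 'I_k] =
    \prod_i (x (s i) : 'M[ext R m]_n) by rewrite prodE big_map enumT [index_enum _]unlock.
by rewrite mulr_sign; case: (odd_perm s).
Qed.

Lemma rmorph_standard (W W' : pzRingType) (f : {rmorphism W -> W'}) k (y : 'I_k -> W) :
  f (standard y) = standard (f \o y).
Proof.
rewrite rmorph_sum; apply: eq_bigr => s _.
by rewrite rmorphM rmorph_sign rmorph_prod.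
Qed.

Section OddProducts.
Variables (K : comNzRingType) (m : nat).
Implicit Types x y w : ext K m.

Lemma parity_prod_odd (I : Type) (r : seq I) (F : I -> ext K m) :
  (forall i, F i \in parity true) -> \prod_(i <- r) F i \in parity (odd (size r)).
Proof.
move=> oddF; elim: r => [|i r IHr]; first by rewrite big_nil parity1.
by rewrite big_cons; apply: (parityM (oddF i) IHr).
Qed.

Lemma mul_odd_swap p x w y : x \in parity true -> w \in parity p -> y \in parity true ->
  x * w * y = - (y * w * x).
Proof.
move=> hx hw hy; rewrite -mulrA (parityC hx (parityM hw hy)) (parityC hw hy).
by case: p {hw}; rewrite /= ?mul1r ?mulN1r ?mulNr ?opprK.
Qed.

Lemma prod_odd_tperm k (F : 'I_k -> ext K m) (i j : 'I_k) :
  (forall l, F l \in parity true) -> i != j ->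
  \prod_l F (tperm i j l) = - \prod_l F l.
Proof.
case: k F i j => [F [] //|k] F i j; wlog ltij : i j / (i < j)%N.
  move=> swap_lt oddF neqij; have [ltij|ltji|/val_inj eqij] := ltngtP i j.
  - exact: swap_lt.
  - by rewrite tpermC swap_lt // eq_sym.
  - by rewrite eqij eqxx in neqij.
move=> oddF _.
have prod_nat G : \prod_(l < k.+1) G l = \prod_(0 <= l < k.+1) G (inord l) :> ext K m.
  by rewrite big_mkord; apply: eq_bigr => l _; rewrite inord_val.
have split_ij G : \prod_(0 <= l < k.+1) G l = \prod_(0 <= l < i) G l *
    (G i * \prod_(i.+1 <= l < j) G l * G j) * \prod_(j.+1 <= l < k.+1) G l :> ext K m.
  rewrite (big_cat_nat (n := i)) ?(ltnW (ltn_ord i)) //=.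
  rewrite (big_ltn (m := i)) // (big_cat_nat (m := i.+1) (n := j)) ?(ltnW (ltn_ord j)) //=.
  by rewrite (big_ltn (m := j)) // !mulrA.
rewrite !prod_nat !split_ij !inord_val tpermL tpermR.
rewrite (mul_odd_swap (oddF j) (parity_prod_odd _ (fun l => oddF (tperm i j _))) (oddF i)).
rewrite mulrN mulNr; congr (- (_ * (_ * _ * _) * _));
  apply: eq_big_nat => l ltl; rewrite tpermD // -val_eqE /= inordK;
  have := ltn_ord j; have := ltn_ord i; lia.
Qed.

Lemma prod_odd_perm k (F : 'I_k -> ext K m) (s : 'S_k) : (forall l, F l \in parity true) ->
  \prod_l F (s l) = (-1) ^+ s * \prod_l F l.
Proof.
move=> oddF; have [ts ->] := prod_tpermP s; elim: ts => [_|t ts IHts] /=.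
  by rewrite big_nil odd_perm1 mul1r; apply: eq_bigr => l _; rewrite perm1.
case/andP=> neqt /IHts{}IHts; rewrite big_cons odd_mul_tperm neqt.
under eq_bigr do rewrite permM.
rewrite (prod_odd_tperm (F := fun l => F ((\prod_(t <- ts) tperm t.1 t.2)%g l))) //.
by rewrite IHts signrN mulNr.
Qed.

Lemma prod_odd_eq0 k (F : 'I_k -> ext K m) i j : torsion_free K ->
  (forall l, F l \in parity true) -> i != j -> F i = F j -> \prod_l F l = 0.
Proof.
move=> tfK oddF neqij Fij; apply: (torsion_free_eq_opp (torsion_free_ext tfK)).
rewrite -(prod_odd_tperm oddF neqij); apply: eq_bigr => l _.
by case: tpermP => // ->; rewrite Fij.
Qed.

Lemma exp_sum_standard (W : pzRingType) (h : {rmorphism ext K m -> W}) k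
    (theta : 'I_k -> ext K m) (y : 'I_k -> W) : torsion_free K ->
  (forall i, theta i \in parity true) -> (forall x i, GRing.comm (h x) (y i)) ->
  (\sum_i h (theta i) * y i) ^+ k = h (\prod_i theta i) * standard y.
Proof.
move=> tfK odd_theta comm_hy.
rewrite -[X in _ ^+ X]card_ord -prodr_const bigA_distr_bigA /=.
have termE (f : {ffun 'I_k -> 'I_k}) : \prod_i (h (theta (f i)) * y (f i)) =
    h (\prod_i theta (f i)) * \prod_i y (f i).
  by rewrite prodrM_comm ?rmorph_prod // => i j _ _; apply: comm_hy.
rewrite (eq_bigr _ (fun f _ => termE f)) (bigID (fun f : {ffun _} => injectiveb f)) /=.
rewrite [X in _ + X]big1 ?addr0 => [|f /injectivePn[i [j neqij fij]]]; last first.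
  by rewrite (prod_odd_eq0 (F := theta \o f) tfK _ neqij) ?rmorph0 ?mul0r //= fij.
rewrite mulr_sumr (reindex (fun s : 'S_k => pval s)) /=; last first.
  exists (insubd (1%g : 'S_k)) => [s _|f fi]; first exact: valKd.
  exact: (insubdK (1%g : 'S_k) fi).
apply: eq_big => [s|s _]; first exact: (valP s).
under eq_bigr do rewrite pvalE; under [X in _ * X]eq_bigr do rewrite pvalE.
by rewrite prod_odd_perm // rmorphM rmorph_sign -mulrA [RHS]mulrA commr_sign mulrA.
Qed.

End OddProducts.

Section Generators.
Variables (K : comNzRingType) (k : nat).
Local Notation g i := (emono [set i] 1 : ext K k).

Lemma parity_generator i : g i \in parity true.
Proof. by have := @parity_emono K k [set i] 1; rewrite cards1. Qed.

Lemma prod_generators (l : seq 'I_k) : uniq l ->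
  exists b : bool, \prod_(i <- l) g i = emono [set:: l] ((-1) ^+ b).
Proof.
elim: l => [_|i l IHl] /=.
  by exists false; rewrite big_nil set_nil -[RHS]extoneE.
case/andP=> il /IHl[b prodE]; exists (odd (grinv [set i] [set:: l]) (+) b).
rewrite big_cons prodE emonoM disjoints1 inE il mulr1 -signr_odd signr_addb.
by rewrite set_cons.
Qed.

Lemma prod_generators_mulI (z : K) : (\prod_(i < k) g i) * extC k z = 0 -> z = 0.
Proof.
have [b prodE] := prod_generators (index_enum_uniq 'I_k).
rewrite prodE mul_emono_extC => /ffunP/(_ [set:: index_enum 'I_k]).
by rewrite !ffunE eqxx => z0; rewrite -(signrMK b z) z0 mulr0.
Qed.

End Generators.

Section ScalarsAndCoordinates.
Variables (R R' : pzRingType) (f : {rmorphism R -> R'}) (m n : nat).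
Implicit Types (r : R') (w : ext 'M[R']_n m) (x : 'M[ext R m]_n).

Definition ext_scalar : {rmorphism R' -> ext 'M[R']_n m} := @extC 'M[R']_n m \o @scalar_mx R' n.

Definition ext_of_map_mx : {rmorphism 'M[ext R m]_n -> ext 'M[R']_n m} :=
  @ext_of_mx R' m n \o map_mx (@map_ext R R' f m).

Lemma ext_scalarE r w S i j : (ext_scalar r * w) S i j = r * w S i j.
Proof. by rewrite extCME -[_ * _]/(_ *m _) mul_scalar_mx mxE. Qed.

Lemma ext_of_map_mxE x S i j : ext_of_map_mx x S i j = f (x i j S).
Proof. by rewrite ffunE !mxE ffunE. Qed.

Lemma comm_ext_scalar r x : (forall a b, GRing.comm (f a) b) ->
  GRing.comm (ext_scalar r) (ext_of_map_mx x).
Proof.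
move=> f_central; apply: comm_extC => S; rewrite /GRing.comm -mulmxE mul_scalar_mx.
apply/matrixP => i j; rewrite mxE [RHS]mxE (bigD1 j) //= big1 ?addr0 => [|l /negPf neqlj].
  by rewrite ext_of_map_mxE f_central mxE eqxx.
by rewrite [r%:M _ _]mxE neqlj mulr0.
Qed.

End ScalarsAndCoordinates.

Lemma standard_ext_torsion_free_eq0 (K : comNzRingType) m n
    (x : 'I_(4 * n.+1 - 2) -> 'M[ext K m]_n.+1) : torsion_free K ->
  (1 <= n)%N -> (m <= 3)%N -> standard x = 0.
Proof.
set N := (4 * n.+1 - 2)%N in x * => tfK n_gt0 m_le3.
pose Lam := ext K (2 + N); pose g i : Lam := emono [set i] 1.
pose theta i := g (rshift 2 i).
pose eta := g (lshift N ord0); pose zeta := g (lshift N (lift ord0 ord0)).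
pose phi := ext_of_map_mx (extC (2 + N) : {rmorphism K -> Lam}) m n.+1.
pose h := ext_scalar Lam m n.+1; pose Y := \sum_i h (theta i) * phi (x i).
have central_const (z : K) (a : Lam) : GRing.comm (extC _ z) a.
  exact/comm_parity_false/parity_extC.
have exp_Y : Y ^+ N = h (\prod_i theta i) * standard (phi \o x).
  apply: exp_sum_standard; first exact: tfK.
    by move=> i; apply: parity_generator.
  by move=> a i; apply: comm_ext_scalar.
have odd_Y S : Y S \is a mxOver (parity true).
  apply/mxOverP => i j; rewrite ext_sumE summxE; apply: rpred_sum => l _.
  rewrite ext_scalarE ext_of_map_mxE.
  exact: (parityM (parity_generator K _) (parity_extC _ _)).
have := odd_ext_exp_eq0 tfK (parity_generator K _ : eta \in _)
  (parity_generator K _ : zeta \in _) odd_Y n_gt0 m_le3.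
rewrite -/N exp_Y -rmorph_standard -[extC m _]/(h _) mulrA -rmorphM.
rewrite (_ : _ * \prod_i theta i = \prod_i g i) => [prod0|]; last first.
  by rewrite big_split_ord big_ord_recl big_ord1.
apply/matrixP => i j; apply/ffunP => S; rewrite mxE ffunE.
apply: (@prod_generators_mulI K (2 + N)).
have := congr1 (fun w : ext 'M[Lam]_n.+1 m => w S i j) prod0.
by rewrite ext_scalarE ext_of_map_mxE !ffunE mxE.
Qed.

Lemma standard_multilinear (R : comPzRingType) (W : pzRingType) (rho : {rmorphism R -> W})
    (C : finType) (B : C -> W) k (r : 'I_k -> C -> R) :
  (forall z c, GRing.comm (rho z) (B c)) ->
  (forall f : 'I_k -> C, standard (B \o f) = 0) ->
  standard (fun i => \sum_c rho (r i c) * B c) = 0.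
Proof.
move=> comm_rB standard_B0.
transitivity (\sum_(f : {ffun 'I_k -> C}) rho (\prod_i r i (f i)) * standard (B \o f)); last first.
  by rewrite big1 // => f _; rewrite standard_B0 mulr0.
under [RHS]eq_bigr do rewrite mulr_sumr.
rewrite exchange_big; apply: eq_bigr => s _ /=.
rewrite bigA_distr_bigA mulr_sumr /=.
pose permute (p : 'S_k) (f : {ffun 'I_k -> C}) := [ffun i => f (p i)].
have permuteK p : cancel (permute p) (permute p^-1%g).
  by move=> f; apply/ffunP => i; rewrite !ffunE permKV.
rewrite (reindex_inj (can_inj (permuteK s))); apply: eq_bigr => f _.
rewrite prodrM_comm => [|i j _ _]; last exact: comm_rB.
rewrite -rmorph_prod [in RHS](reindex_perm s) !mulrA (commr_sign (rho _)).
by congr (_ * rho _ * _); apply: eq_bigr => i _; rewrite ffunE.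
Qed.

Lemma standard_ext_eq0_of_int (R : comPzRingType) m n k :
  (forall x : 'I_k -> 'M[ext int m]_n, standard x = 0) ->
  forall x : 'I_k -> 'M[ext R m]_n, standard x = 0.
Proof.
move=> standard_int0 x.
pose C := ('I_n * 'I_n * {set 'I_m})%type.
pose unit_mx (c : C) : 'M[ext int m]_n :=
  \matrix_(i, j) (if (i, j) == c.1 then emono c.2 1 else 0).
pose B := ext_of_map_mx intr m n \o unit_mx : C -> ext 'M[R]_n m.
have xE i : ext_of_mx (x i) = \sum_(c : C) ext_scalar R m n (x i c.1.1 c.1.2 c.2) * B c.
  apply/ffunP => S; apply/matrixP => a b; rewrite ffunE mxE ext_sumE summxE.
  rewrite (bigD1 (a, b, S)) //= big1 ?addr0.
    by rewrite ext_scalarE ext_of_map_mxE mxE eqxx ffunE eqxx mulr1.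
  case=> -[a' b'] S' /= ne; rewrite ext_scalarE ext_of_map_mxE mxE.
  case: eqP => [[ea eb]|_]; rewrite ffunE ?mulr0 //.
  case: eqP => [eS|_]; last by rewrite mulr0.
  by move: ne; rewrite ea eb eS eqxx.
apply: ext_of_mx_inj; rewrite raddf0 rmorph_standard.
transitivity (standard (fun i => \sum_(c : C) ext_scalar R m n (x i c.1.1 c.1.2 c.2) * B c)).
  by apply: eq_bigr => s _; congr (_ * _); apply: eq_bigr => i _; apply: xE.
apply: standard_multilinear => [z c|f].
  by apply: comm_ext_scalar => a b; apply: mulrC.
by rewrite -(rmorph_standard _ (unit_mx \o f)) standard_int0 rmorph0.
Qed.

Theorem theorem1p2 (R : comPzRingType) (n : nat) (hn : (2 <= n)%N) :
  std_identity R 2 n (4 * n - 2) /\ std_identity R 3 n (4 * n - 2).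
Proof.
case: n hn => [//|n] hn; split=> x; rewrite std_polyE; apply: standard_ext_eq0_of_int => y.
  exact: standard_ext_torsion_free_eq0 torsion_free_int _ _.
exact: standard_ext_torsion_free_eq0 torsion_free_int _ _.
Qed.
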